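(* For $2n\to+\infty$, the cumulative distribution function $\mathcal P(2k\le 2\alpha)$ of the time spent on the positive side by the simple symmetric random walk in the time interval from $0$ to $2n$ can be approximated by $$\mathcal P(2k\le 2\alpha)\approx\frac{2}{\pi}\arcsin\sqrt{\frac{\alpha}{n}} .$$
   Context: The simple symmetric random walk is $S_0=0$, $S_j=X_1+\dots+X_j$, where $X_1,\dots,X_{2n}$ are independent with $\mathcal P(X_i=1)=\mathcal P(X_i=-1)=\tfrac12$. The walk is said to spend the time from $j-1$ to $j$ on the positive side if at least one of $S_{j-1}$, $S_j$ is positive, and on the negative side otherwise. Let $p_{2k,2n}$ be the probability that in the time interval from $0$ to $2n$ the walk spends $2k$ time units on the positive side and $2n-2k$ time units on the negative side. For $\alpha\in\mathbb N$ with $0\le\alpha\le n$, the cumulative distribution function is $\mathcal P(2k\le 2\alpha)=\sum_{k=0}^{\alpha}p_{2k,2n}$, i.e. the probability that the walk spends at most $2\alpha$ time units on the positive side. The symbol $\approx$ denotes approximation for large $n$; no specific mode of convergence or error bound is stated. *)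

(* Defs.v *)
From mathcomp Require Import all_boot all_order all_algebra.
From mathcomp Require Import all_classical all_reals all_analysis.
Set Implicit Arguments.
Unset Strict Implicit.
Unset Printing Implicit Defensive.
Import Order.TTheory GRing.Theory Num.Theory.
Import numFieldNormedType.Exports.
Local Open Scope classical_set_scope.
Local Open Scope ring_scope.

Definition mutually_independent (d : measure_display) (T : measurableType d)
    (R : realType) (P : probability T R) (I : finType)
    (X : I -> {RV P >-> R}) : Prop :=
  forall (J : {set I}) (B : I -> set R),
    (forall i, measurable (B i)) ->
    P (\bigcap_(i in [set` J]) (X i @^-1` B i)) =
    (\prod_(i in J) P (X i @^-1` B i))%E.

(* The steps are indexed from 0: [X i] is the step from time i to time i + 1. *)
Definition symmetric_steps (d : measure_display) (T : measurableType d)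
    (R : realType) (P : probability T R) (m : nat)
    (X : 'I_m -> {RV P >-> R}) : Prop :=
  mutually_independent X /\
  forall i, pmf (X i) 1 = 2^-1 /\ pmf (X i) (-1) = 2^-1.

Section Walk.
Variables (d : measure_display) (T : measurableType d) (R : realType).
Variables (P : probability T R) (m : nat) (X : 'I_m -> {RV P >-> R}).

Definition walk (j : nat) (w : T) : R := \sum_(i < m | (i < j)%N) X i w.

Definition on_positive_side (i : 'I_m) (w : T) : bool :=
  (0 < walk i w) || (0 < walk i.+1 w).

Definition positive_time (w : T) : nat := #|[pred i | on_positive_side i w]|.
Definition negative_time (w : T) : nat := #|[pred i | ~~ on_positive_side i w]|.

End Walk.

(* The probability p_{2k,2n}. *)
Definition positive_time_prob (d : measure_display) (T : measurableType d)
    (R : realType) (P : probability T R) (n : nat)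
    (X : 'I_(2 * n) -> {RV P >-> R}) (k : nat) : R :=
  fine (P [set w | positive_time X w = (2 * k)%N /\
                   negative_time X w = (2 * n - 2 * k)%N]).

Definition positive_time_cdf (d : measure_display) (T : measurableType d)
    (R : realType) (P : probability T R) (n : nat)
    (X : 'I_(2 * n) -> {RV P >-> R}) (alpha : nat) : R :=
  \sum_(0 <= k < alpha.+1) positive_time_prob X k.

(* Main.v *)
(* Condition on the first step: the number of walks of length [m] started at [s]
   that spend [k] time units on the positive side satisfies a recursion in [m],
   solved by a product of two return counts plus the count of walks avoiding 0.
   At [s = 0] this gives p_{2k,2n} = u_k u_{n-k} with u_k = C(2k,k) / 4^k.

   Both k u_k^2 (nondecreasing) and (k + 1/2) u_k^2 (nonincreasing) have the same
   limit c, so u_k u_{n-k} is comparable to c / sqrt(k (n - k)), and hence, by the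
   mean value theorem for cos, to increments of the angle
   arc(x) = acos(1 - 2x) = 2 asin(sqrt x).  Telescoping bounds the distribution
   function above by u_n + c arc((a+1)/n).  Since the total mass is 1, this forces
   c pi >= 1, a similar lower bound gives c pi <= 1, and so c = 1/pi without
   Wallis' formula.  The lower bound on the distribution function follows from the
   upper one by the symmetry k <-> n - k. *)
Require Import Defs.
From mathcomp Require Import all_boot all_order all_algebra.
From mathcomp Require Import all_classical all_reals all_analysis.
From mathcomp Require Import zify ring lra.
Import Order.TTheory GRing.Theory Num.Theory.
Import numFieldNormedType.Exports.
Local Open Scope ring_scope.

(** * Counting sign words by their positive time *)

Definition step (b : bool) : int := if b then 1 else -1.

Fixpoint word_time (s : int) (l : seq bool) : nat :=
  if l is b :: l' then
    (((0 < s)%R || (0 < s + step b)%R) + word_time (s + step b)%R l')%N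
  else 0%N.

Definition word_count (m : nat) (s : int) (k : nat) : nat :=
  #|[set t : m.-tuple bool | word_time s t == k]|.

(* The number of walks of length [j] from [s] (or from [- s]) to 0; at [s = 0] both
   first steps are equivalent by symmetry. *)
Fixpoint paths0 (j s : nat) : nat :=
  match j, s with
  | 0, s => (s == 0)%N
  | j'.+1, 0 => (2 * paths0 j' 1)%N
  | j'.+1, s'.+1 => (paths0 j' s' + paths0 j' s'.+2)%N
  end.

(* For [m + s] even, the number of walks of length [m] from [s] that avoid 0: by
   the reflection principle, those of all walks that end in ]- s, s] when started
   at 0. *)
Definition paths_pos (m s : nat) : nat :=
  (\sum_(i < s) (paths0 m i + paths0 m i.+1))%N.

Section Counting.
Local Open Scope nat_scope.

Lemma card_tuple_cons (m : nat) (p : pred (seq bool)) :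
  #|[set t : m.+1.-tuple bool | p t]| =
  #|[set t : m.-tuple bool | p (true :: t)]| +
  #|[set t : m.-tuple bool | p (false :: t)]|.
Proof.
have inj b : injective (fun t : m.-tuple bool => [tuple of b :: t]).
  by move=> t1 t2 /(congr1 (@behead_tuple _ _)) /(congr1 val) /= ?; apply: val_inj.
rewrite -(card_imset _ (inj true)) -(card_imset _ (inj false)).
rewrite -cardsUI [X in _ + X](_ : _ = 0) ?addn0; last first.
  apply/eqP; rewrite cards_eq0 -finset.subset0; apply/fintype.subsetP => t.
  rewrite inE.
  by case/andP=> /imsetP [t1 _ ->] /imsetP [t2 _] /(congr1 val).
apply: eq_card => t; rewrite !inE; apply/idP/orP.
  case/tupleP: t => -[] t /= pt; [left|right]; apply/imsetP; exists t => //;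
  by rewrite inE.
by case=> /imsetP [t1]; rewrite inE => ? ->.
Qed.

Lemma word_count0 s k : word_count 0 s k = (k == 0).
Proof.
rewrite /word_count; case: eqP => [->|/eqP k0].
  rewrite -[RHS](_ : #|[set: 0.-tuple bool]| = 1); last by rewrite cardsT card_tuple.
  by apply: eq_card => t; rewrite !inE tuple0.
apply/eqP; rewrite cards_eq0 -finset.subset0; apply/fintype.subsetP => t.
by rewrite inE tuple0 eq_sym (negbTE k0).
Qed.

(** Condition on the first step. The factors [_ <= k] guard the truncated subtractions: a first step
    that takes more than [k] leaves no word. A down step is on the positive side exactly when
    [0 < s]. *)
Lemma word_countS m s k :
  word_count m.+1 s k =
  (((0 < s)%R || (0 < s + 1)%R) <= k) *
    word_count m (s + 1)%R (k - ((0 < s)%R || (0 < s + 1)%R))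
  + ((0 < s)%R <= k) * word_count m (s - 1)%R (k - (0 < s)%R).
Proof.
rewrite /word_count (card_tuple_cons m (fun l => word_time s l == k)) /=.
have e (c : nat) (s' : int) : #|[set t : m.-tuple bool | c + word_time s' t == k]| =
   (c <= k) * #|[set t : m.-tuple bool | word_time s' t == k - c]|.
  case: leqP => ck; rewrite ?mul1n ?mul0n.
    by apply: eq_card => t; rewrite !inE; lia.
  apply/eqP; rewrite cards_eq0 -finset.subset0; apply/fintype.subsetP => t.
  by rewrite inE; lia.
rewrite !e; congr (_ + _).
by have -> : (0 < s)%R || (0 < s - 1)%R = (0 < s)%R by lia.
Qed.

Lemma paths0_gt j s : j < s -> paths0 j s = 0.
Proof.
elim: j s => [|j IHj] [|s] //=; rewrite ltnS => js.
by rewrite !IHj //; lia.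
Qed.

(** Pascal's rule matches the recursion of [paths0]; at [s = 0] the doubled term is a Pascal sum of
    two equal central entries. *)
Lemma paths0E s i : paths0 (s + 2 * i) s = 'C(s + 2 * i, i).
Proof.
move: {-2}(s + 2 * i) (erefl (s + 2 * i)) => j.
elim: j s i => [|j IHj] [|s] [|i] //= e; try lia.
- rewrite (IHj 1 i) ?binS; last lia.
  have -> : 'C(j, i.+1) = 'C(j, i) by rewrite -[RHS]bin_sub; [congr binomial|]; lia.
  by rewrite mul2n addnn.
- by rewrite (IHj s 0) ?paths0_gt ?bin0; lia.
- rewrite (IHj s i.+1) ?(IHj s.+2 i) ?binS; lia.
Qed.

Lemma paths0_odd j s : odd (j + s) -> paths0 j s = 0.
Proof.
elim: j s => [|j IHj] [|s] //= os; rewrite !IHj //; lia.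
Qed.

(** This is the first-step recursion of walks avoiding 0. A step down from 1 contributes
    [paths_pos m 0], an empty sum. *)
Lemma paths_posS m s :
  paths_pos m.+1 s.+1 = paths_pos m s.+2 + paths_pos m s.
Proof.
rewrite /paths_pos; elim: s => [|s IHs].
  by rewrite !big_ord_recr !big_ord0 /=; lia.
rewrite big_ord_recr IHs [in RHS]big_ord_recr [X in _ = _ + X]big_ord_recr /=.
by lia.
Qed.

(** Parity kills [paths0 m 0]. From 1, avoiding 0 and ending at 0 are thus equally frequent, which
    settles the extreme times at start 0. *)
Lemma paths_pos1 m : odd m -> paths_pos m 1 = paths0 m 1.
Proof.
by move=> om; rewrite /paths_pos big_ord_recr big_ord0 /= paths0_odd ?addn0.
Qed.

Lemma word_count_gt m s k : m < k -> word_count m s k = 0.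
Proof.
elim: m s k => [|m IHm] s k mk; first by rewrite word_count0; lia.
by rewrite word_countS !IHm; lia.
Qed.

(* The first passage through 0 splits a path started at [s]; the last term
   counts the paths that never reach 0. *)
Lemma word_countE m s k : k <= m -> ~~ odd (m + s) ->
  (word_count m s%:Z k =
     paths0 k s * paths0 (m - k) 0 + (k == m) * paths_pos m s) /\
  (word_count m (- s%:Z)%R k =
     paths0 k 0 * paths0 (m - k) s + (k == 0) * paths_pos m s).
Proof.
elim: m s k => [|m IHm] s k.
  rewrite leqn0 => /eqP -> ev; rewrite !word_count0 /paths_pos subn0 /=.
  case: s ev => [|s] _; first by rewrite big_ord0.
  rewrite big_ord_recl big1 ?addn0 //=.
move=> km ev; rewrite !word_countS; case: s ev => [|s] ev.
  have om : odd m by lia.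
  have D1 := paths_pos1 m om.
  have D0 : paths_pos m.+1 0 = 0 by rewrite /paths_pos big_ord0.
  rewrite oppr0 /= subn0 mul1n D0 muln0 addn0.
  have H1 : (0 < k) * word_count m 1 (k - 1) =
     (0 < k) * (paths0 k.-1 1 * paths0 (m.+1 - k) 0 + (k == m.+1) * paths_pos m 1).
    rewrite -[1%R]/(1%:Z); case: k km => [|k] // km.
    by rewrite subn1 /= subSS eqSS; have [||-> _] := IHm 1 k; lia.
  have H2 : word_count m (-1)%R k =
     (k <= m) * (paths0 k 0 * paths0 (m - k) 1 + (k == 0) * paths_pos m 1).
    case: (leqP k m) => km'; last by rewrite word_count_gt.
    by rewrite mul1n -[1%R]/(1%:Z); have [||_ ->] := IHm 1 k; lia.
  rewrite sub0r add0r H1 H2.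
  have E1 : k <= m -> 2 * paths0 (m - k) 1 = paths0 (m.+1 - k) 0.
    by move=> ?; rewrite subSn.
  rewrite muln0 addn0.
  have both (x y : nat) : x = y -> x = y /\ x = y by move=> ->.
  (* Time 0 forces a down step and full time an up step; there the return and avoidance terms agree
     by [D1] and add up. In between, each direction gives half of the product. *)
  apply: both; case: k km H1 H2 E1 => [|k] km _ _ E1.
    have := E1 isT; rewrite !subn0 /=; lia.
  rewrite [k.+1.-1]/= [k.+1 == 0]/= subSS eqSS [paths0 k.+1 0]/=.
  have [e|?] := eqVneq k m; first by subst k; rewrite ltnn subnn /=; lia.
  have e : k < m by lia.
  rewrite e -[m - k](subSS k m) -(E1 e) /=; lia.
have -> : (s.+1%:Z + 1 = s.+2%:Z)%R by lia.
have -> : (s.+1%:Z - 1 = s%:Z)%R by lia.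
have -> : (- s.+1%:Z + 1 = - s%:Z)%R by lia.
have -> : (- s.+1%:Z - 1 = - s.+2%:Z)%R by lia.
have -> : ((0 < - s%:Z) = false)%R by lia.
rewrite /= subn0 !mul1n paths_posS; split.
  case: k km => [|k] km.
    by rewrite ltn0 !mul0n.
  rewrite !mul1n subSS subn0 eqSS.
  have [||-> _] := IHm s.+2 k; [lia|lia|].
  have [||-> _] := IHm s k; [lia|lia|].
  by rewrite /= subSS; lia.
(* From a negative start the first step is on the negative side, so full positive time is impossible
   and both sides vanish. *)
have [->|km'] := eqVneq k m.+1.
  by rewrite !word_count_gt // subnn muln0.
rewrite subSn; last by lia.
have [||_ ->] := IHm s.+2 k; [lia|lia|].
have [||_ ->] := IHm s k; [lia|lia|].
by rewrite /=; lia.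
Qed.

Lemma word_count_even n k : k <= n ->
  word_count (2 * n) 0 (2 * k) = 'C(2 * k, k) * 'C(2 * (n - k), n - k).
Proof.
move=> kn; have [||-> _] := word_countE (2 * n) 0 (2 * k); [lia|lia|].
rewrite /paths_pos big_ord0 muln0 addn0 -mulnBr -[2 * k]add0n paths0E.
by rewrite -[2 * (n - k)]add0n paths0E.
Qed.

Lemma sum_word_count m s : \sum_(k < m.+1) word_count m s k = 2 ^ m.
Proof.
elim: m s => [|m IHm] s; first by rewrite big_ord_recl big_ord0 word_count0.
under eq_bigr => k _ do rewrite word_countS.
have e (c : bool) (s' : int) :
    \sum_(k < m.+2) (c <= k) * word_count m s' (k - c) = 2 ^ m.
  case: c.
    rewrite big_ord_recl mul0n add0n -[RHS](IHm s').
    by apply: eq_bigr => i _; rewrite lift0 subn1 mul1n.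
  rewrite big_ord_recr /= word_count_gt ?subn0 // muln0 addn0 -[RHS](IHm s').
  by apply: eq_bigr => i _; rewrite subn0 mul1n.
by rewrite big_split /= !e addnn expnS mul2n.
Qed.

(** Both sides count all words of length [2 * n], sorted by positive time from start 0. Odd times do
    not occur, because [paths0] vanishes there. *)
Lemma sum_central_binomial n :
  \sum_(k < n.+1) 'C(2 * k, k) * 'C(2 * (n - k), n - k) = 4 ^ n.
Proof.
rewrite -[4]/(2 ^ 2) -expnM -(sum_word_count (2 * n) 0).
have e f j : (forall i, odd i -> i < 2 * j -> f i = 0) ->
    \sum_(k < (2 * j).+1) f k = \sum_(k < j.+1) f (2 * k).
  elim: j => [|j IHj] fo; first by rewrite !big_ord_recl !big_ord0.
  rewrite -[2 * _]/(2 * j.+1) big_ord_recr mulnS /= big_ord_recr /=.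
  rewrite [in RHS]big_ord_recr -IHj ?mulnS //=.
    by rewrite fo ?addn0; lia.
  by move=> i oi ij; apply: fo; lia.
rewrite e; first by apply: eq_bigr => k _; rewrite word_count_even // -ltnS.
move=> i oi i2n; have [||-> _] := word_countE (2 * n) 0 i; [lia|lia|].
by rewrite paths0_odd ?addn0 // mul0n /paths_pos big_ord0 muln0.
Qed.
End Counting.

Local Open Scope classical_set_scope.
Local Open Scope ring_scope.

(** * The angle [acos (1 - 2 * x)] *)

Section Arc.
Variable R : realType.
Implicit Types x y : R.

(** In this form the cosine is affine in [x], and [x -> 1 - x] becomes the reflection of [acos]. *)
Definition arc x : R := acos (1 - 2 * x).

Lemma arc_itv x : 0 <= x <= 1 -> arc x \in `[0, pi].
Proof. by move=> hx; rewrite in_itv /= acos_ge0 ?acos_lepi; lra. Qed.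

Lemma cos_arc x : 0 <= x <= 1 -> cos (arc x) = 1 - 2 * x.
Proof. by move=> hx; rewrite acosK // in_itv /=; lra. Qed.

Lemma sin_arc x : 0 <= x <= 1 -> sin (arc x) = 2 * Num.sqrt (x * (1 - x)).
Proof.
move=> hx; rewrite sin_acos; last lra.
rewrite (_ : 1 - (1 - 2 * x) ^+ 2 = 2 ^+ 2 * (x * (1 - x))); last by ring.
by rewrite sqrtrM ?sqrtr_sqr ?ger0_norm // sqr_ge0.
Qed.

(** The right side lies in [[0, pi]], where [acos] inverts [cos], and has cosine [1 - 2 * x] by the
    double-angle formula. *)
Lemma arcE x : 0 <= x <= 1 -> arc x = 2 * asin (Num.sqrt x).
Proof.
move=> /andP [x0 x1].
have s1 : -1 <= Num.sqrt x <= 1.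
  rewrite (le_trans _ (sqrtr_ge0 x)) ?lerN10 //=.
  by rewrite -[leRHS]sqrtr1 ler_sqrt.
have s0 : 0 <= asin (Num.sqrt x).
  rewrite leNgt -ltr_sin ?in_itv /= ?asin_geNpi2 ?asin_lepi2 //.
    by rewrite asinK ?in_itv // sin0 -leNgt sqrtr_ge0.
  by rewrite oppr_le0 divr_ge0 ?pi_ge0.
rewrite /arc -[RHS]cosK; last first.
  have := asin_lepi2 s1.
  by rewrite in_itv /=; move: (@pi _) (asin _) s0 => p s; lra.
congr acos; rewrite [X in cos X]mulr_natl mulr2n cosD -!expr2 cos2sin2.
by rewrite asinK ?in_itv // sqr_sqrtr //; ring.
Qed.

Lemma arc0 : arc 0 = 0.
Proof. by rewrite /arc mulr0 subr0 acos1. Qed.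

Lemma arc_half : arc 2^-1 = pi / 2.
Proof. by rewrite /arc divff // subrr acos0. Qed.

Lemma arcC x : 0 <= x <= 1 -> arc (1 - x) = pi - arc x.
Proof.
by move=> hx; rewrite /arc -acosN; [congr acos; ring|lra].
Qed.

Lemma arc1 : arc 1 = pi.
Proof. by rewrite -[1 in LHS]subr0 arcC ?arc0 ?subr0 //; lra. Qed.

Lemma le_arc x y : 0 <= x -> x <= y -> y <= 1 -> arc x <= arc y.
Proof.
move=> x0 xy y1; rewrite leNgt -ltr_cos ?arc_itv ?cos_arc -?leNgt //; lra.
Qed.

(** Applying the mean value theorem to [cos] between the two angles avoids the derivative of [acos],
    which blows up at the endpoints. *)
Lemma arc_MVT x y : 0 <= x -> x <= y -> y <= 1 ->
  exists2 z, arc x <= z <= arc y & 2 * (y - x) = sin z * (arc y - arc x).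
Proof.
move=> x0 xy y1.
have [z zI e] := @MVT_segment _ cos (- sin) _ _ (le_arc _ _ x0 xy y1)
  (fun t _ => is_derive_cos t)
  (continuous_subspaceT (@continuous_cos R)).
exists z; first by move: zI; rewrite in_itv.
move: e; rewrite !cos_arc; [rewrite [(- sin) z]/(- sin z) mulNr|lra|lra].
by move: (sin z * _) => t; lra.
Qed.

Lemma sin_le_half (a b : R) : 0 <= a -> a <= b -> b <= pi / 2 -> sin a <= sin b.
Proof.
move=> a0 ab bp; rewrite leNgt ltr_sin -?leNgt // in_itv /=; lra.
Qed.

(** Up to 1/2 the angles stay in [[0, pi / 2]], where [sin] increases, so [sin z] is at most
    [sin (arc y)]. The twin bound below uses [sin (arc x)]. *)
Lemma arc_increment_ge x y : 0 <= x -> x <= y -> y <= 2^-1 ->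
  y - x <= Num.sqrt (y * (1 - y)) * (arc y - arc x).
Proof.
move=> x0 xy y2; have y1 : y <= 1 by lra.
have [z /andP [xz zy] e] := arc_MVT x y x0 xy y1.
have /andP [ax0 _] : 0 <= arc x <= pi.
  by have := arc_itv x; rewrite in_itv /=; apply; lra.
have ay2 : arc y <= pi / 2 by rewrite -arc_half le_arc; lra.
have zs : sin z <= sin (arc y) by rewrite sin_le_half // (le_trans ax0).
have axy := le_arc x y x0 xy y1.
rewrite sin_arc in zs; last lra.
have := ler_wpM2r _ zs; rewrite -(@subr_ge0 _ (arc x)) in axy.
by move=> /(_ _ axy); rewrite -e; lra.
Qed.

Lemma arc_increment_le x y : 0 <= x -> x <= y -> y <= 2^-1 ->
  Num.sqrt (x * (1 - x)) * (arc y - arc x) <= y - x.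
Proof.
move=> x0 xy y2; have y1 : y <= 1 by lra.
have [z /andP [xz zy] e] := arc_MVT x y x0 xy y1.
have /andP [ax0 _] : 0 <= arc x <= pi.
  by have := arc_itv x; rewrite in_itv /=; apply; lra.
have ay2 : arc y <= pi / 2 by rewrite -arc_half le_arc; lra.
have zs : sin (arc x) <= sin z by rewrite sin_le_half // (le_trans zy).
have axy := le_arc x y x0 xy y1.
rewrite sin_arc in zs; last lra.
have := ler_wpM2r _ zs; rewrite -(@subr_ge0 _ (arc x)) in axy.
by move=> /(_ _ axy); rewrite -e; lra.
Qed.

(** This makes the increments of [arc] over a step 1/n uniformly small, even where its slope is
    infinite. Comparing cosines leaves [x (1 - y) <= sqrt (x (1 - x) y (1 - y))]. *)
Lemma arcB x y : 0 <= x -> x <= y -> y <= 1 -> arc y - arc x <= arc (y - x).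
Proof.
move=> x0 xy y1.
have hx : 0 <= x <= 1 by lra.
have hy : 0 <= y <= 1 by lra.
have := arc_itv x hx; have := arc_itv y hy; rewrite !in_itv /= => hay hax.
have axy := le_arc x y x0 xy y1.
rewrite leNgt -ltr_cos ?arc_itv ?cos_arc ?in_itv //=; try lra.
rewrite -leNgt cosB !cos_arc // !sin_arc //.
have : Num.sqrt ((x * (1 - y)) ^+ 2) <=
    Num.sqrt (y * (1 - y)) * Num.sqrt (x * (1 - x)).
  rewrite -sqrtrM; last nra.
  rewrite ler_sqrt; last by rewrite !mulr_ge0; lra.
  rewrite expr2 mulrACA [leRHS]mulrACA [_ * (1 - x)]mulrC.
  by rewrite ler_pM ?mulr_ge0 //; nra.
rewrite sqrtr_sqr ger0_norm; last nra.
by move: (Num.sqrt _) (Num.sqrt _) => s t; lra.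
Qed.

Lemma arc_inv_small (e : R) : 0 < e ->
  \forall n \near \oo, (0 < n)%N && (arc n%:R^-1 < e).
Proof.
(* The cap at [pi] keeps [t] where [cos] is decreasing, so that [arc n%:R^-1 < t] amounts to
   [cos t < 1 - 2 / n]. *)
move=> e0; pose t := Num.min e pi.
have tI : 0 < t <= pi by rewrite lt_min e0 pi_gt0 ge_min lexx orbT.
have ct : 0 < 1 - cos t.
  by rewrite subr_gt0 -cos0 ltr_cos ?in_itv /=; lra.
near=> n.
have n0 : (0 < n)%N by near: n; exists 1%N.
have n2 : n%:R^-1 < (1 - cos t) / 2 :> R.
  rewrite -[ltRHS]invrK ltf_pV2 ?posrE ?invr_gt0 ?divr_gt0 ?ltr0n //.
  near: n; exact: nbhs_infty_gtr.
have nI : 0 <= (n%:R^-1 : R) <= 1 by rewrite invr_ge0 ler0n invf_le1 ?ltr0n ?ler1n.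
rewrite n0 /=; apply: (@lt_le_trans _ _ t); last by rewrite ge_min lexx.
by rewrite -ltr_cos ?arc_itv ?in_itv /= ?cos_arc //; lra.
Unshelve. all: by end_near.
Qed.

End Arc.

(** * Central binomial probabilities and the arcsine limit *)

Section CentralBinomial.
Variable R : realType.

Definition cbin (n : nat) : R := 'C(2 * n, n)%:R / 4 ^+ n.

Lemma cbin0 : cbin 0 = 1.
Proof. by rewrite /cbin muln0 bin0 expr0 divr1. Qed.

Lemma cbin_gt0 n : 0 < cbin n.
Proof. by rewrite divr_gt0 ?exprn_gt0 // ltr0n bin_gt0; lia. Qed.

Lemma cbinS n : cbin n.+1 * (2 * n.+1%:R) = cbin n * (2 * n%:R + 1).
Proof.
have e : ('C(2 * n.+1, n.+1) * n.+1 = 'C(2 * n, n) * (2 * (2 * n + 1)))%N.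
  have e1 : 'C((2 * n).+1, n.+1) = 'C((2 * n).+1, n).
    by rewrite -bin_sub; [congr binomial|]; lia.
  have := mul_bin_diag (2 * n).+1 n.
  rewrite (_ : (2 * n.+1 = (2 * n).+2)%N) ?(binS _.+1) /=; [rewrite e1|]; lia.
rewrite /cbin exprS; move/(congr1 (fun i : nat => i%:R : R)): e.
rewrite !natrM natrD natrM => e.
have p0 : (4 ^+ n : R) != 0 by rewrite expf_neq0.
have -> (c m : R) : c / (4 * 4 ^+ n) * (2 * m) = (c * m) / (2 * 4 ^+ n) by field.
by rewrite e; field.
Qed.

Lemma cbin_sqrS n :
  cbin n.+1 ^+ 2 * (2 * n.+1%:R) ^+ 2 = cbin n ^+ 2 * (2 * n%:R + 1) ^+ 2.
Proof. by rewrite -!exprMn cbinS. Qed.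

(** After [cbin_sqrS] this reduces to [4 n (n + 1) <= (2 n + 1)^2]. *)
Lemma nondecreasing_cbin :
  nondecreasing_seq (fun n => n%:R * cbin n ^+ 2).
Proof.
apply/nondecreasing_seqP => n.
have := cbin_sqrS n; have := sqr_ge0 (cbin n).
have : (0 : R) <= n%:R by [].
rewrite -[n.+1]addn1 natrD.
move: (n%:R : R) (cbin n ^+ 2) (cbin _ ^+ 2) => m a b m0 a0 e.
rewrite -(@ler_pM2r _ (4 * (m + 1))); last lra.
by rewrite (_ : (m + 1) * b * _ = b * (2 * (m + 1)) ^+ 2); [rewrite e; nra|ring].
Qed.

(** After [cbin_sqrS] this reduces to [(2 n + 1) (2 n + 3) <= (2 n + 2)^2]. *)
Lemma nonincreasing_cbin :
  nonincreasing_seq (fun n => (n%:R + 2^-1) * cbin n ^+ 2).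
Proof.
apply/nonincreasing_seqP => n.
have := cbin_sqrS n; have := sqr_ge0 (cbin n).
have : (0 : R) <= n%:R by [].
rewrite -[n.+1]addn1 natrD.
move: (n%:R : R) (cbin n ^+ 2) (cbin _ ^+ 2) => m a b m0 a0 e.
rewrite -(@ler_pM2r _ ((2 * (m + 1)) ^+ 2)); last by rewrite exprn_gt0; lra.
rewrite -mulrA e; have : 0 <= a * (2 * m + 1) by rewrite mulr_ge0; lra.
by move: (a * _) => c; nra.
Qed.

(* By monotonicity this is the limit c of the header. *)
Definition cbin_lim : R := sup (range (fun n => n%:R * cbin n ^+ 2)).

Lemma cbin_le_lim n : n%:R * cbin n ^+ 2 <= cbin_lim.
Proof.
apply: ub_le_sup; last by exists n.
exists (2^-1) => _ [m _ <-].
have := nonincreasing_cbin _ _ (leq0n m); rewrite cbin0 expr1n add0r mulr1 /=.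
by have := sqr_ge0 (cbin m); move: (_ ^+ 2) => a; lra.
Qed.

(** Each term of the nondecreasing sequence is below each term of the nonincreasing one: compare
    them at the larger index. *)
Lemma cbin_lim_le n : cbin_lim <= (n%:R + 2^-1) * cbin n ^+ 2.
Proof.
apply: ge_sup; first by exists (0%:R * cbin 0 ^+ 2), 0%N.
move=> _ [m _ <-]; have /orP [nm|mn] := leq_total n m.
  apply: le_trans (nonincreasing_cbin _ _ nm).
  by rewrite ler_wpM2r ?sqr_ge0 //; lra.
apply: (le_trans (nondecreasing_cbin _ _ mn)).
by rewrite ler_wpM2r ?sqr_ge0 //; lra.
Qed.

Lemma cbin_lim_itv : 0 < cbin_lim <= 1.
Proof.
rewrite (lt_le_trans _ (cbin_le_lim 1)) ?mul1r ?exprn_gt0 ?cbin_gt0 //=.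
apply: (le_trans (cbin_lim_le 0)).
by rewrite cbin0; lra.
Qed.

End CentralBinomial.

(** * Comparing partial sums with the angle *)

Section ArcsineLaw.
Variable R : realType.
Local Notation cbin := (@cbin R).
Local Notation arc := (@arc R).
Local Notation cbin_lim := (cbin_lim R).

Definition arcsine_weight (n k : nat) : R := cbin k * cbin (n - k).

(** The bound [a] is excluded, so the distribution function at [a] is [arcsine_sum n a.+1]. *)
Definition arcsine_sum (n a : nat) : R := \sum_(k < a) arcsine_weight n k.

Lemma arcsine_weight_ge0 n k : 0 <= arcsine_weight n k.
Proof. by rewrite mulr_ge0 // ltW // cbin_gt0. Qed.

Lemma arcsine_sumS n a :
  arcsine_sum n a.+1 = arcsine_sum n a + arcsine_weight n a.
Proof. exact: big_ord_recr. Qed.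

Lemma arcsine_weightC n k : (k <= n)%N ->
  arcsine_weight n (n - k) = arcsine_weight n k.
Proof. by move=> kn; rewrite /arcsine_weight subKn // mulrC. Qed.

Lemma arcsine_sum_total n : arcsine_sum n n.+1 = 1.
Proof.
have := congr1 (fun i : nat => i%:R : R) (sum_central_binomial n).
rewrite natrX natr_sum => e.
rewrite -(@divff _ (4 ^+ n : R)) ?expf_neq0 // -[X in X / _]e mulr_suml.
apply: eq_bigr => k _; rewrite /arcsine_weight /cbin natrM mulf_div -exprD.
by rewrite subnKC // -ltnS.
Qed.

Lemma arcsine_sumC n a : (a <= n.+1)%N ->
  arcsine_sum n (n.+1 - a) = 1 - arcsine_sum n a.
Proof.
move=> an; rewrite -(arcsine_sum_total n) /arcsine_sum.
rewrite -!(big_mkord xpredT (arcsine_weight n)).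
rewrite (@big_cat_nat _ _ _ a 0 n.+1) //= addrC addrK.
rewrite big_nat_rev /= -[in RHS](add0n a) [in RHS]big_addn.
rewrite !big_mkord; apply: eq_bigr => k _.
rewrite add0n -arcsine_weightC; last by have := ltn_ord k; lia.
by congr arcsine_weight; have := ltn_ord k; lia.
Qed.

(** Squared, the left side is [k u_k^2] times [(n - k) u_{n-k}^2] over [n^2], and both factors are
    at most [c]. *)
Lemma arcsine_weight_le n k : (0 < k < n)%N ->
  arcsine_weight n k * Num.sqrt (k%:R / n%:R * (1 - k%:R / n%:R)) <= cbin_lim / n%:R.
Proof.
move=> /andP [k0 kn]; have n0 : (0 : R) < n%:R by rewrite ltr0n; lia.
have /andP [L0 _] := cbin_lim_itv R.
have d0 : 0 <= cbin_lim / n%:R by rewrite divr_ge0 // ltW.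
rewrite -[leRHS]ger0_norm // -sqrtr_sqr.
rewrite -[arcsine_weight n k]ger0_norm ?arcsine_weight_ge0 // -sqrtr_sqr.
rewrite -sqrtrM ?sqr_ge0 // ler_sqrt ?sqr_ge0 //.
have -> : arcsine_weight n k ^+ 2 * (k%:R / n%:R * (1 - k%:R / n%:R)) =
   (k%:R * cbin k ^+ 2) * ((n - k)%:R * cbin (n - k) ^+ 2) / n%:R ^+ 2.
  rewrite (natrB R (ltnW kn)) /arcsine_weight.
  move: (cbin k) (cbin (n - k)) (k%:R : R) (n%:R : R) n0 => u v x y y0.
  by field; rewrite gt_eqF.
rewrite [(cbin_lim / _) ^+ 2]expr_div_n ler_pM2r ?invr_gt0 ?exprn_gt0 //.
by rewrite [leRHS]expr2 ler_pM ?cbin_le_lim // mulr_ge0 ?sqr_ge0.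
Qed.

(** With this midpoint, [1 - x] is [(n - k + 1/2) / (n + 1)], so squaring produces two terms of the
    nonincreasing sequence, each at least [c]. *)
Lemma arcsine_weight_ge n k (x := (k%:R + 2^-1) / n.+1%:R : R) : (k <= n)%N ->
  cbin_lim / n.+1%:R <= arcsine_weight n k * Num.sqrt (x * (1 - x)).
Proof.
move=> kn; have n0 : (0 : R) < n.+1%:R by rewrite ltr0n.
have /andP [L0 _] := cbin_lim_itv R.
have d0 : 0 <= cbin_lim / n.+1%:R by rewrite divr_ge0 // ltW.
rewrite -[leLHS]ger0_norm // -sqrtr_sqr.
rewrite -[arcsine_weight n k]ger0_norm ?arcsine_weight_ge0 // -sqrtr_sqr.
rewrite -sqrtrM ?sqr_ge0 //.
have -> : arcsine_weight n k ^+ 2 * (x * (1 - x)) =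
   ((k%:R + 2^-1) * cbin k ^+ 2) *
   (((n - k)%:R + 2^-1) * cbin (n - k) ^+ 2) / n.+1%:R ^+ 2.
  rewrite /x (natrB R kn) /arcsine_weight.
  have -> : n%:R = n.+1%:R - 1 :> R by rewrite -natr1 addrK.
  move: (cbin k) (cbin (n - k)) (k%:R : R) (n.+1%:R : R) n0 => u v z y y0.
  by field; rewrite gt_eqF.
rewrite ler_wsqrtr // [(cbin_lim / _) ^+ 2]expr_div_n.
rewrite ler_pM2r ?invr_gt0 ?exprn_gt0 //.
by rewrite [leLHS]expr2 ler_pM ?cbin_lim_le // ltW.
Qed.

Lemma arcsine_weight_le_left n k : (k.+1 < n)%N -> (2 * k.+1 <= n)%N ->
  arcsine_weight n k.+1 <= cbin_lim * (arc (k.+1%:R / n%:R) - arc (k%:R / n%:R)).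
Proof.
move=> kn k2n; have n0 : (0 : R) < n%:R by rewrite ltr0n; lia.
have /andP [L0 _] := cbin_lim_itv R.
have x2 : k.+1%:R / n%:R <= 2^-1 :> R.
  by rewrite ler_pdivrMr // ler_pdivlMl // -natrM ler_nat.
have x0 : 0 < k.+1%:R / n%:R :> R by rewrite divr_gt0.
have s0 : 0 < Num.sqrt (k.+1%:R / n%:R * (1 - k.+1%:R / n%:R)) :> R.
  by rewrite sqrtr_gt0 mulr_gt0 //; lra.
rewrite -(ler_pM2r s0); apply: (le_trans (@arcsine_weight_le _ _ _)) => //.
rewrite -[leRHS]mulrA [(_ - _) * _]mulrC ler_pM2l //.
apply: le_trans (@arc_increment_ge _ _ _ _ _ x2).
- by rewrite -mulrBl -natrB // subSnn mul1r.
- by rewrite divr_ge0.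
- by rewrite ler_pM2r ?invr_gt0 // ler_nat.
Qed.

(** Mirror image of the left half under [k -> n - k]; the cell charged now lies to the right of
    [k / n]. *)
Lemma arcsine_weight_le_right n k : (0 < k < n)%N -> (n <= 2 * k)%N ->
  arcsine_weight n k <= cbin_lim * (arc (k.+1%:R / n%:R) - arc (k%:R / n%:R)).
Proof.
move=> /andP [k0 kn] k2n; rewrite -arcsine_weightC; last lia.
have n0 : (0 : R) < n%:R by rewrite ltr0n; lia.
have -> : (n - k = (n - k.+1).+1)%N by lia.
apply: le_trans (@arcsine_weight_le_left _ _ _ _) _; [lia|lia|].
have e j : (j <= n)%N -> arc ((n - j)%:R / n%:R) = pi - arc (j%:R / n%:R).
  move=> jn; rewrite natrB // mulrBl divff ?gt_eqF // arcC //.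
  by rewrite divr_ge0 //= ler_pdivrMr // mul1r ler_nat.
rewrite (_ : (n - k.+1).+1 = n - k)%N; last lia.
by rewrite !e //; [lra|lia].
Qed.

Lemma arcsine_sum_le_half n a : (0 < n)%N -> (2 * a <= n)%N ->
  arcsine_sum n a.+1 <= cbin n + cbin_lim * arc (a%:R / n%:R).
Proof.
move=> n0; elim: a => [|a IHa] an.
  rewrite /arcsine_sum big_ord1 mul0r arc0 mulr0 addr0 /arcsine_weight.
  by rewrite cbin0 mul1r subn0.
rewrite arcsine_sumS.
have [|lt|e] := ltngtP a.+1 n; [|lia|lia].
move=> lt; have := arcsine_weight_le_left _ _ lt an.
have a2n : (2 * a <= n)%N by lia.
by have := IHa a2n; rewrite mulrBr; lra.
Qed.

(** Up to the middle each weight is charged to the cell on its left, beyond it to the cell on its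
    right, whence [a.+1]. The weight at 0, which has no cell, is [cbin n]. *)
Lemma arcsine_sum_le n a : (a < n)%N ->
  arcsine_sum n a.+1 <= cbin n + cbin_lim * arc (a.+1%:R / n%:R).
Proof.
have /andP [L0 _] := cbin_lim_itv R.
elim: a => [|a IHa] an; have n0 : (0 < n)%N by lia.
  rewrite (le_trans (arcsine_sum_le_half n 0 n0 (leq0n _))) //.
  rewrite lerD2l ler_pM2l // mul0r arc0.
  have /arc_itv : 0 <= (1%:R / n%:R : R) <= 1; last by rewrite in_itv => /andP [].
  by rewrite divr_ge0 //= ler_pdivrMr ?ltr0n // mul1r ler1n.
have [h|h] := leqP (2 * a.+1) n.
  apply: (le_trans (arcsine_sum_le_half _ _ n0 h)).
  rewrite lerD2l ler_pM2l // le_arc ?divr_ge0 //.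
    by rewrite ler_pM2r ?invr_gt0 ?ltr0n // ler_nat.
  by rewrite ler_pdivrMr ?ltr0n // mul1r ler_nat.
have an' : (a < n)%N by lia.
have := IHa an'; have := @arcsine_weight_le_right n a.+1 an (ltnW h).
rewrite (arcsine_sumS _ a.+1).
by rewrite mulrBr; lra.
Qed.

Lemma cbin_small (e : R) : 0 < e -> \forall n \near \oo, cbin n < e.
Proof.
move=> e0; near=> n.
have n0 : (0 < n)%N by near: n; exists 1%N.
have n0' : (0 : R) < n%:R by rewrite ltr0n.
have ne : e ^- 2 < n%:R by near: n; exact: nbhs_infty_gtr.
rewrite -(@ltr_pXn2r _ 2) ?nnegrE ?ltW ?cbin_gt0 //.
rewrite -(@ltr_pM2l _ n%:R) // (le_lt_trans (cbin_le_lim R n)) //.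
have /andP [_ L1] := cbin_lim_itv R; rewrite (le_lt_trans L1) //.
by rewrite -ltr_pdivrMr ?exprn_gt0 // mul1r.
Unshelve. all: by end_near.
Qed.

Lemma cbin_lim_pi_ge1 : 1 <= cbin_lim * pi.
Proof.
rewrite leNgt; apply/negP => lt1.
(* The total mass 1 is at most [2 u_n + c pi], with one [u_n] from each extreme weight; hence half
   of the gap. *)
have [|n [n0 nlt]] := @filter_ex _ \oo _ (fun n => (0 < n)%N /\
  cbin n < (1 - cbin_lim * pi) / 2).
  apply: filterS2 (@cbin_small ((1 - cbin_lim * pi) / 2) _) (nbhs_infty_gt 0) => //.
  lra.
have := arcsine_sum_total n; rewrite /arcsine_sum big_ord_recr /=.
case: n n0 nlt => // n _ nlt.
have := @arcsine_sum_le n.+1 n (ltnSn n); rewrite /arcsine_sum.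
rewrite divff // arc1 {3}/arcsine_weight subnn cbin0 mulr1.
by move: (\sum_(_ < _) _) => S; lra.
Qed.

(** Weight [k] dominates the cell between the midpoints of [k] and [k + 1]. For [n = 2 K + 2] the
    midpoint of [K + 1] is exactly 1/2, the end of the range of [arc_increment_le]. *)
Lemma arcsine_sum_ge K j : (j <= K.+1)%N ->
  cbin_lim * (arc ((j%:R + 2^-1) / (2 * K).+3%:R) - arc (2^-1 / (2 * K).+3%:R))
  <= arcsine_sum (2 * K).+2 j.
Proof.
have /andP [L0 _] := cbin_lim_itv R.
have N0 : 0 < (2 * K).+3%:R :> R by [].
elim: j => [|k IHk] kK; first by rewrite /arcsine_sum big_ord0 add0r subrr mulr0.
rewrite arcsine_sumS.
have kK' : (k <= K.+1)%N by lia.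
have {IHk} := IHk kK'.
suff : cbin_lim * (arc ((k.+1%:R + 2^-1) / (2 * K).+3%:R) -
     arc ((k%:R + 2^-1) / (2 * K).+3%:R)) <= arcsine_weight (2 * K).+2 k.
  by rewrite !mulrBr; lra.
have k0 : 0 <= k%:R :> R by [].
have kR : k%:R <= K%:R :> R by rewrite ler_nat.
have NE : (2 * K).+3%:R = 2 * K%:R + 3 :> R by rewrite -addn3 natrD natrM.
set x := (k%:R + 2^-1) / _; set y := (k.+1%:R + 2^-1) / _.
have x0 : 0 < x by rewrite divr_gt0 //; lra.
have xy : x <= y by rewrite ler_pM2r ?invr_gt0 // -natr1; lra.
have y2 : y <= 2^-1 by rewrite ler_pdivrMr // NE -natr1; lra.
have s0 : 0 < Num.sqrt (x * (1 - x)) by rewrite sqrtr_gt0 mulr_gt0 //; lra.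
have kn : (k <= (2 * K).+2)%N by lia.
rewrite -(ler_pM2r s0); apply: (le_trans _ (@arcsine_weight_ge _ _ kn)).
rewrite -[leLHS]mulrA [(_ - _) * _]mulrC ler_pM2l //.
apply: (le_trans (@arc_increment_le _ _ _ (ltW x0) xy y2)).
by rewrite /x /y -mulrBl -natr1 (_ : _ - _ = 1) ?mul1r //; ring.
Qed.

Lemma cbin_lim_pi_le1 : cbin_lim * pi <= 1.
Proof.
have /andP [L0 L1] := cbin_lim_itv R.
rewrite leNgt; apply/negP => lt1.
have [|K /andP [K0 Klt]] := @filter_ex _ \oo _ (fun n => (0 < n)%N &&
  (arc n%:R^-1 < (cbin_lim * pi - 1) / 2)).
  by apply: arc_inv_small; lra.
have := @arcsine_sum_ge K K.+1 (leqnn _).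
have NE : (2 * K).+3%:R = 2 * K%:R + 3 :> R by rewrite -addn3 natrD natrM.
have K0R : 1 <= K%:R :> R by rewrite ler1n.
rewrite NE -natr1 (_ : (K%:R + 1 + 2^-1) / _ = 2^-1); last by field; lra.
rewrite arc_half.
have : arc (2^-1 / (2 * K%:R + 3)) <= arc K%:R^-1.
  rewrite le_arc ?divr_ge0 //; try lra.
    by rewrite ler_pdivrMr ?ler_pdivlMl; lra.
  by rewrite invf_le1; lra.
(* The weights 0 to [K] mirror those from [K + 2] on; the middle weight is nonnegative. *)
have : arcsine_sum (2 * K).+2 K.+1 <= 2^-1.
  have := @arcsine_sumC (2 * K).+2 K.+1.
  rewrite (_ : (2 * K).+3 - K.+1 = K.+2)%N; last lia.
  have := arcsine_weight_ge0 (2 * K).+2 K.+1.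
  rewrite (arcsine_sumS _ K.+1).
  have l : (K.+1 <= (2 * K).+3)%N by lia.
  move=> w0 /(_ l); lra.
have b0 : 0 <= arc K%:R^-1.
  have /arc_itv : 0 <= (K%:R^-1 : R) <= 1; last by rewrite in_itv => /andP [].
  by rewrite invr_ge0 ler0n invf_le1; lra.
move: (arc _) (arc _) (arcsine_sum _ _) Klt b0 => a b S Klt b0 S2 ab.
have : cbin_lim * a <= cbin_lim * b by rewrite ler_pM2l.
have : cbin_lim * b <= b.
  by rewrite ler_piMl.
by rewrite mulrBr; lra.
Qed.

Lemma cbin_limE : cbin_lim = pi^-1.
Proof.
apply: (mulIf (lt0r_neq0 (pi_gt0 R))); rewrite mulVf ?lt0r_neq0 ?pi_gt0 //.
by apply/eqP; rewrite eq_le cbin_lim_pi_le1 cbin_lim_pi_ge1.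
Qed.

Lemma arcsine_law (e : R) : 0 < e -> \forall n \near \oo,
  forall a, (a <= n)%N -> `|arcsine_sum n a.+1 - arc (a%:R / n%:R) / pi| < e.
Proof.
move=> e0; have e2 : 0 < e / 2 by lra.
have p0 := pi_gt0 R; have p1 : (1 : R) <= pi.
  by have := pihalf_ge1 R; lra.
have ep : 0 < e / 2 * pi by rewrite mulr_gt0.
apply: filterS2 (cbin_small _ e2) (@arc_inv_small R _ ep) => n cn /andP [n0 an] a.
have n0' : (0 : R) < n%:R by rewrite ltr0n.
rewrite leq_eqVlt => /predU1P [->|aln].
  by rewrite arcsine_sum_total divff ?arc1 ?divff ?subrr ?normr0 ?gt_eqF.
have up := @arcsine_sum_le n a aln.
have aR : a%:R <= n%:R :> R by rewrite ler_nat ltnW.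
have aI : 0 <= (a%:R / n%:R : R) <= 1 by rewrite divr_ge0 //= ler_pdivrMr // mul1r.
have na : (n - a = (n - a.+1).+1)%N by rewrite subnSK.
have an' : (n - a.+1 < n)%N by rewrite -na leq_subr.
(* The upper bound at [n - a - 1] is turned into a lower bound at [a] by [arcsine_sumC] and
   [arcC]. *)
have lo := @arcsine_sum_le n _ an'.
rewrite -na (natrB R (ltnW aln)) mulrBl divff ?gt_eqF // arcC // in lo.
have aln' : (a.+1 <= n.+1)%N by exact: leqW.
rewrite -subSS (arcsine_sumC _ _ aln') cbin_limE mulrBr mulVf ?gt_eqF // in lo.
rewrite [pi^-1 * _]mulrC in lo.
have a1 : a.+1%:R / n%:R <= 1 :> R by rewrite ler_pdivrMr // mul1r ler_nat.
have aa : a%:R / n%:R <= a.+1%:R / n%:R :> R.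
  by rewrite ler_pM2r ?invr_gt0 // ler_nat.
have /andP [a0 _] := aI.
have inc := le_lt_trans (@arcB R _ _ a0 aa a1).
have eN : a.+1%:R / n%:R - a%:R / n%:R = n%:R^-1 :> R.
  by rewrite -mulrBl -natr1 [_ - _]addrAC subrr add0r mul1r.
rewrite eN in inc; have {}inc := inc _ an.
rewrite -ltr_pdivrMr // mulrBl in inc.
rewrite cbin_limE [pi^-1 * _]mulrC in up.
by rewrite ltr_norml; lra.
Qed.
End ArcsineLaw.

(** * The law of the positive time *)

Lemma word_timeE (s : int) (l : seq bool)
    (pos := fun j : nat => s + \sum_(b <- take j l) step b) :
  word_time s l = (\sum_(i < size l) ((0 < pos i)%R || (0 < pos i.+1)%R))%N.
Proof.
rewrite /pos => {pos}; elim: l s => [|b l IHl] s; first by rewrite big_ord0.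
rewrite big_ord_recl /= take0 big_nil addr0 big_seq1 IHl.
by congr (_ + _)%N; apply: eq_bigr => i _; rewrite !big_cons !addrA.
Qed.

Section Words.
Context (d : measure_display) (T : measurableType d) (R : realType).
Context (P : probability T R) (m : nat) (X : 'I_m -> {RV P >-> R}).

(** The intersection runs over the full finite index set so that [mutually_independent] applies
    directly. *)
Definition word_event (t : m.-tuple bool) : set T :=
  \bigcap_(i in [set` [set: 'I_m]%SET]) (X i @^-1` [set (step (tnth t i))%:~R]).

Lemma word_eventP t w : word_event t w -> forall i, X i w = (step (tnth t i))%:~R.
Proof. by move=> tw i; apply: tw; rewrite /= inE. Qed.

Lemma measurable_word_event t : measurable (word_event t).
Proof.
by apply: fin_bigcap_measurable => // i _; apply: measurable_funPTI.
Qed.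

Lemma trivIset_word_event (D : set (m.-tuple bool)) : trivIset D word_event.
Proof.
move=> t1 t2 _ _ [w [/word_eventP w1 /word_eventP w2]].
apply: eq_from_tnth => i; have := w1 i; rewrite w2 => /eqP.
by rewrite eqr_int; case: (tnth t1 i) (tnth t2 i) => [] [].
Qed.

Lemma walk_word t w j : word_event t w -> (j <= m)%N ->
  walk X j w = (\sum_(b <- take j t) step b)%:~R.
Proof.
move=> /word_eventP tw jm; rewrite /walk.
have st : size (take j t) = j by rewrite size_takel ?size_tuple.
rewrite (big_nth false) st big_mkord rmorph_sum /=.
rewrite (big_ord_widen _ (fun i => (step (nth false (take j t) i))%:~R) jm).
by apply: eq_bigr => i ij; rewrite tw nth_take // (tnth_nth false).
Qed.

Lemma positive_time_word t w : word_event t w ->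
  positive_time X w = word_time 0 t.
Proof.
move=> tw; rewrite /positive_time -sum1_card big_mkcond word_timeE size_tuple /=.
apply: eq_bigr => i _; rewrite inE /on_positive_side !(walk_word _ _ _ tw) //.
  by rewrite !ltr0z !add0r; case: ifP.
exact: ltnW.
Qed.

(** The steps are 1 or -1 only almost surely, so this event need not be a union of word events; the
    count is shown measurable instead. *)
Lemma measurable_positive_time k : measurable [set w | positive_time X w = k].
Proof.
have mw j : measurable_fun setT (walk X j).
  rewrite /walk; under eq_fun do rewrite big_mkcond /=.
  by apply: measurable_sum => i; case: (i < j)%N.
have mp : measurable_fun setT (fun w => (positive_time X w)%:R : R).
  have -> : (fun w => (positive_time X w)%:R : R) =
      (fun w => \sum_(i < m) if on_positive_side X i w then 1 else 0).
    apply/funext => w; rewrite /positive_time -sum1_card natr_sum big_mkcond /=.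
    by apply: eq_bigr => i _; rewrite inE; case: ifP.
  apply: measurable_sum => i; apply: measurable_fun_ifT => //.
  by apply: measurable_or; apply: measurable_realfun.measurable_fun_ltr.
rewrite (_ : [set w | _] =
    setT `&` (fun w => (positive_time X w)%:R : R) @^-1` [set k%:R]).
  by apply: mp.
rewrite setTI; apply/seteqP; split => w /=; first by move=> ->.
by move=> /eqP; rewrite eqr_nat => /eqP.
Qed.

Hypothesis Xsym : symmetric_steps X.

Lemma probability_word_event t : P (word_event t) = ((2 ^+ m)^-1)%:E.
Proof.
have [indep sym] := Xsym.
rewrite indep; last by move=> i; exact: measurable_set1.
rewrite (eq_bigr (fun=> (2^-1)%:E)) => [|i _].
  by rewrite prodEFin prodr_const cardsT card_ord exprVn.
rewrite -[LHS]fineK ?fin_num_measure //.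
have [p1 pN1] := sym i; congr EFin.
by case: (tnth t i) => /=; rewrite ?rmorphN.
Qed.

Lemma probability_word_union (p : pred (m.-tuple bool)) :
  P (\bigcup_(t in [set` p]) word_event t) = (#|p|%:R / 2 ^+ m)%:E.
Proof.
have tE := @trivIset_word_event [set` p].
rewrite measure_fin_bigcup //; last by move=> *; exact: measurable_word_event.
rewrite -(bigfs _ (index_enum_uniq _)); last by move=> i _; rewrite mem_index_enum.
rewrite (eq_bigr _ (fun i _ => probability_word_event i)) sumEFin; congr EFin.
by rewrite sumr_const mulr_natl.
Qed.

Lemma probability_positive_time k :
  P [set w | positive_time X w = k] = ((word_count m 0 k)%:R / 2 ^+ m)%:E.
Proof.
set p := fun t : m.-tuple bool => word_time 0 t == k.
rewrite /word_count cardsE -[RHS](probability_word_union p).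
set A := [set w | _]; set V := \bigcup_(t in _) _.
have mE D : measurable (\bigcup_(t in D) word_event t).
  by apply: fin_bigcup_measurable => // t _; exact: measurable_word_event.
have mV : measurable V := mE _.
have VA : V `<=` A.
  by move=> w [t /eqP tk tw]; rewrite /A /= (positive_time_word _ _ tw).
pose U := \bigcup_(t in [set` predT]) word_event t.
have mU : measurable U := mE _.
(* The [2 ^ m] word events already carry total mass 1. *)
have PU : P (~` U) = 0%E.
  rewrite probability_setC // probability_word_union card_tuple card_bool natrX.
  by rewrite divff ?subee // expf_neq0.
have mA := measurable_positive_time k.
rewrite (measureDI P mA mV) (setIidr VA) [X in (X + _)%E](_ : _ = 0%E) ?add0e //.
apply: (@subset_measure0 _ _ _ P _ (~` U)) => //.
- exact: measurableD.
- exact: measurableC.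
move=> w [wA nV] [t _ tw]; apply: nV; exists t => //.
by apply/eqP; rewrite -(positive_time_word _ _ tw).
Qed.

End Words.

Lemma positive_time_probE (d : measure_display) (T : measurableType d)
    (R : realType) (P : probability T R) (n k : nat)
    (X : 'I_(2 * n) -> {RV P >-> R}) : symmetric_steps X -> (k <= n)%N ->
  positive_time_prob X k = arcsine_weight R n k.
Proof.
move=> Xsym kn; rewrite /positive_time_prob.
have -> : [set w | positive_time X w = (2 * k)%N /\
    negative_time X w = (2 * n - 2 * k)%N] = [set w | positive_time X w = (2 * k)%N].
  apply/seteqP; split => w /=; first by case.
  have e : (positive_time X w + negative_time X w = 2 * n)%N.
    by rewrite -[RHS]card_ord; exact: cardC.
  by move=> pk; move: e; rewrite pk; lia.
rewrite probability_positive_time //= word_count_even // natrM.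
rewrite /arcsine_weight /cbin mulf_div -exprD subnKC // exprM.
by rewrite -natrX.
Qed.

Lemma positive_time_cdfE (d : measure_display) (T : measurableType d)
    (R : realType) (P : probability T R) (n a : nat)
    (X : 'I_(2 * n) -> {RV P >-> R}) : symmetric_steps X -> (a <= n)%N ->
  positive_time_cdf X a = arcsine_sum R n a.+1.
Proof.
move=> Xsym an; rewrite /positive_time_cdf big_mkord; apply: eq_bigr => k _.
by rewrite positive_time_probE // (leq_trans _ an) // -ltnS.
Qed.

Theorem proposition3p3 (R : realType) (eps : R) (heps : 0 < eps) :
  \forall n \near \oo,
    forall (d : measure_display) (T : measurableType d) (P : probability T R)
           (X : 'I_(2 * n) -> {RV P >-> R}),
      symmetric_steps X ->
      forall alpha : nat, (alpha <= n)%N ->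
        `| positive_time_cdf X alpha
           - 2 / pi * asin (Num.sqrt (alpha%:R / n%:R)) | < eps.
Proof.
apply: filterS2 (arcsine_law R _ heps) (nbhs_infty_gt 0) => n law n0.
move=> d T P X Xsym a an; rewrite positive_time_cdfE // mulrAC -arcE ?law //.
by rewrite divr_ge0 //= ler_pdivrMr ?ltr0n // mul1r ler_nat.
Qed.
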